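(* Let $k\in\mathbb{N}$ and $p,q\ge\binom{k+1}{2}$. The set of $k$-trivial motions of size-$k$ psd factorizations of matrices in $\mathcal{M}_{\binom{k+1}{2},k}^{p \times q}$, each motion being identified with its associated matrix $D\in\mathbb{R}^{\binom{k+1}{2}\times\binom{k+1}{2}}$, is $\{dI: d\in\mathbb{R}\}$, where $I$ is the $\binom{k+1}{2}\times\binom{k+1}{2}$ identity matrix.
   Context: $\mathcal{S}^k$ is the set of real symmetric $k\times k$ matrices; $\langle X,Y\rangle=\operatorname{trace}(XY)$; psd means symmetric positive semidefinite. A size-$k$ psd factorization of a nonnegative $p\times q$ matrix $M$ is a tuple $A^{(1)},\dots,A^{(p)},B^{(1)},\dots,B^{(q)}$ of $k\times k$ psd matrices with $M_{ij}=\langle A^{(i)},B^{(j)}\rangle$; the psd rank of $M$ is the smallest such $k$. $\mathcal{M}_{\binom{k+1}{2},k}^{p\times q}$ is the set of nonnegative $p\times q$ matrices of rank $\binom{k+1}{2}$ and psd rank $k$. For $1\le s\le k$, an $s$-infinitesimal motion of a size-$k$ psd factorization is a tuple $(\dot A^{(1)},\dots,\dot A^{(p)},\dot B^{(1)},\dots,\dot B^{(q)})$ of matrices in $\mathcal{S}^k$ such that (1) $\langle\dot A^{(i)},B^{(j)}\rangle+\langle A^{(i)},\dot B^{(j)}\rangle=0$ for all $i,j$; and (2) there is $\varepsilon>0$ such that for all $t\in[0,\varepsilon)$ and all nonempty $I\subseteq\{1,\dots,k\}$, $T^s([A^{(i)}+t\dot A^{(i)}]_I)\ge0$ for all $i$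 and $T^s([B^{(j)}+t\dot B^{(j)}]_I)\ge0$ for all $j$. Here $[X]_I$ is the principal minor of $X$ with index set $I$, and $T^s(f)$ is the Taylor polynomial of order $s$ at $t=0$ of the polynomial $f(t)$. (For $s=k$, condition (2) says that $A^{(i)}+t\dot A^{(i)}$ and $B^{(j)}+t\dot B^{(j)}$ are psd for $t\in[0,\varepsilon)$.) Put $\operatorname{vec}(X)=(X_{11},\dots,X_{kk},\sqrt2X_{12},\dots,\sqrt2X_{1k},\sqrt2X_{23},\dots,\sqrt2X_{(k-1)k})$ (row vector). If $M\in\mathcal{M}_{\binom{k+1}{2},k}^{p\times q}$, every $s$-infinitesimal motion is given by a unique $D\in\mathbb{R}^{\binom{k+1}{2}\times\binom{k+1}{2}}$ via $\operatorname{vec}(\dot A^{(i)})=\operatorname{vec}(A^{(i)})D$ and $\operatorname{vec}(\dot B^{(j)})^T=-D\operatorname{vec}(B^{(j)})^T$. The motion is $s$-trivial if the same $D$ gives, by these formulas, an $s$-infinitesimal motion of every size-$k$ psd factorization of every matrix in $\mathcal{M}_{\binom{k+1}{2},k}^{p\times q}$. *)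

(* Defs.v *)
From HB Require Import structures.
From mathcomp Require Import all_boot all_order all_algebra.
From mathcomp Require Import classical_sets reals.
Set Implicit Arguments.
Unset Strict Implicit.
Unset Printing Implicit Defensive.
Import Order.TTheory GRing.Theory Num.Theory.
Local Open Scope ring_scope.
Local Open Scope classical_set_scope.

Definition symmetric_mx (R : realType) (k : nat) (X : 'M[R]_k) : Prop :=
  X^T = X.

Definition psd (R : realType) (k : nat) (X : 'M[R]_k) : Prop :=
  symmetric_mx X /\ forall v : 'rV[R]_k, 0 <= (v *m X *m v^T) 0 0.

Definition inner (R : realType) (k : nat) (X Y : 'M[R]_k) : R := \tr (X *m Y).

Definition nonneg_mx (R : realType) (p q : nat) (M : 'M[R]_(p, q)) : Prop :=
  forall i j, 0 <= M i j.

Definition psd_factorization (R : realType) (p q k : nat) (M : 'M[R]_(p, q))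
    (A : 'I_p -> 'M[R]_k) (B : 'I_q -> 'M[R]_k) : Prop :=
  [/\ forall i, psd (A i),
      forall j, psd (B j)
    & forall i j, M i j = inner (A i) (B j)].

Definition is_psd_rank (R : realType) (p q : nat) (M : 'M[R]_(p, q))
    (k : nat) : Prop :=
  (exists (A : 'I_p -> 'M[R]_k) (B : 'I_q -> 'M[R]_k),
      psd_factorization M A B) /\
  (forall (m : nat) (A : 'I_p -> 'M[R]_m) (B : 'I_q -> 'M[R]_m),
      psd_factorization M A B -> (k <= m)%N).

Definition psd_mx_set (R : realType) (p q k : nat) : set 'M[R]_(p, q) :=
  [set M | [/\ nonneg_mx M, \rank M = 'C(k.+1, 2) & is_psd_rank M k]].
Arguments psd_mx_set : clear implicits.

Definition principal_minor (T : comNzRingType) (k : nat) (X : 'M[T]_k)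
    (I : {set 'I_k}) : T :=
  \det (mxsub (fun a : 'I_#|I| => enum_val a) (fun a : 'I_#|I| => enum_val a) X).

Definition taylor0 (R : realType) (s : nat) (f : {poly R}) : {poly R} :=
  \sum_(n < s.+1) ((f^`(n)).[0] / (n`!)%:R) *: 'X^n.

(* The matrix X + t X', with t the polynomial variable. *)
Definition line_mx (R : realType) (k : nat) (X X' : 'M[R]_k) :
    'M[{poly R}]_k :=
  map_mx polyC X + 'X *: map_mx polyC X'.

Definition infinitesimal_motion (R : realType) (s p q k : nat)
    (A : 'I_p -> 'M[R]_k) (B : 'I_q -> 'M[R]_k)
    (A' : 'I_p -> 'M[R]_k) (B' : 'I_q -> 'M[R]_k) : Prop :=
  [/\ forall i, symmetric_mx (A' i),
      forall j, symmetric_mx (B' j),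
      forall i j, inner (A' i) (B j) + inner (A i) (B' j) = 0
    & exists2 eps : R, 0 < eps &
        forall (t : R) (I : {set 'I_k}), 0 <= t < eps -> (0 < #|I|)%N ->
          (forall i,
            0 <= (taylor0 s (principal_minor (line_mx (A i) (A' i)) I)).[t]) /\
          (forall j,
            0 <= (taylor0 s (principal_minor (line_mx (B j) (B' j)) I)).[t])].

(* Strictly upper triangular positions in row-major order:
   (1,2), ..., (1,k), (2,3), ..., (k-1,k). *)
Definition upper_pairs (k : nat) : seq ('I_k * 'I_k) :=
  [seq ij : 'I_k * 'I_k <- [seq (i, j) | i <- enum 'I_k, j <- enum 'I_k]
    | (ij.1 < ij.2)%N].

Definition vec_seq (R : realType) (k : nat) (X : 'M[R]_k) : seq R :=
  [seq X i i | i <- enum 'I_k] ++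
  [seq Num.sqrt 2 * X ij.1 ij.2 | ij <- upper_pairs k].

Definition vec (R : realType) (k : nat) (X : 'M[R]_k) : 'rV[R]_'C(k.+1, 2) :=
  \row_l (vec_seq X)`_l.

Lemma size_vec_seq (R : realType) (k : nat) (X : 'M[R]_k) :
  size (vec_seq X) = 'C(k.+1, 2).
Proof.
have -> : size (vec_seq X) = (size (enum 'I_k) + size (upper_pairs k))%N.
  by rewrite size_cat !size_map.
rewrite size_enum_ord binS bin1 addnC; congr (_ + _)%N.
rewrite size_filter count_flatten -map_comp sumnE big_map big_enum /=.
rewrite (eq_bigr (fun i : 'I_k => (k - i.+1)%N)); last first.
  move=> i _; rewrite count_map.
  rewrite (eq_count (a2 := preim val (fun m => (i < m)%N))) // -count_map.
  rewrite val_enum_ord.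
  have -> : iota 0 k = iota 0 i.+1 ++ iota i.+1 (k - i.+1).
    by rewrite -iotaD subnKC // ltn_ord.
  rewrite count_cat (_ : count _ (iota 0 _) = 0)%N; last first.
    apply/eqP; rewrite -leqn0 leqNgt -has_count; apply/hasPn => m.
    by rewrite mem_iota add0n ltnS -leqNgt => /andP[].
  apply/eqP; rewrite add0n -[X in _ == X](size_iota i.+1) -all_count.
  by apply/allP => m; rewrite mem_iota => /andP[].
rewrite -(big_mkord xpredT (fun i => (k - i.+1)%N)) big_nat_rev /= add0n.
rewrite -bin2_sum; apply: eq_big_nat => i /andP[_ ltik].
by rewrite subnSK // subKn // ltnW.
Qed.

Definition motion_given_by (R : realType) (p q k : nat)
    (D : 'M[R]_'C(k.+1, 2))
    (A : 'I_p -> 'M[R]_k) (B : 'I_q -> 'M[R]_k)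
    (A' : 'I_p -> 'M[R]_k) (B' : 'I_q -> 'M[R]_k) : Prop :=
  (forall i, vec (A' i) = vec (A i) *m D) /\
  (forall j, (vec (B' j))^T = - (D *m (vec (B j))^T)).

(* vec is a bijection from the symmetric matrices onto the row vectors, so the
   existentially quantified motion (whose entries are symmetric) is the only
   candidate determined by D. *)
Definition motion_of_all_factorizations (R : realType) (p q k s : nat)
    (D : 'M[R]_'C(k.+1, 2)) : Prop :=
  forall (M : 'M[R]_(p, q)) (A : 'I_p -> 'M[R]_k) (B : 'I_q -> 'M[R]_k),
    psd_mx_set R p q k M -> psd_factorization M A B ->
    exists (A' : 'I_p -> 'M[R]_k) (B' : 'I_q -> 'M[R]_k),
      motion_given_by D A B A' B' /\ infinitesimal_motion s A B A' B'.
Arguments motion_of_all_factorizations : clear implicits.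

(* A motion is identified with its matrix D. *)
Definition trivial_motions (R : realType) (p q k s : nat) :
    set 'M[R]_'C(k.+1, 2) :=
  [set D | exists (M : 'M[R]_(p, q)) (A : 'I_p -> 'M[R]_k)
                  (B : 'I_q -> 'M[R]_k)
                  (A' : 'I_p -> 'M[R]_k) (B' : 'I_q -> 'M[R]_k),
      [/\ psd_mx_set R p q k M,
          psd_factorization M A B,
          infinitesimal_motion s A B A' B',
          motion_given_by D A B A' B'
        & motion_of_all_factorizations R p q k s D]].
Arguments trivial_motions : clear implicits.

(* Main.v *)
Require Import Defs.
From mathcomp Require Import all_boot all_order all_algebra.
From mathcomp Require Import classical_sets reals.
From mathcomp Require Import ring lra.
Local Open Scope ring_scope.
Local Open Scope classical_set_scope.

Set Implicit Arguments.
Unset Strict Implicit.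
Unset Printing Implicit Defensive.
Import Order.TTheory GRing.Theory Num.Theory.

(** A scalar [D = d I] moves [A i] to [(1 + t d) A i] and [B j] to
    [(1 - t d) B j], which stay psd for small [t], and the inner products are
    constant to first order ([scalar_infinitesimal_motion]). Minors of a
    [k x k] line of matrices have degree at most [k] in [t], so the truncation
    at order [k] is harmless, and the minors of a psd matrix are nonnegative
    ([psd_principal_minor_ge0]).

    For the converse a single well chosen factorization is enough. Take on both
    sides the matrices [E_bb] and [(e_b + e_c)^T (e_b + e_c)] with [b < c]. They
    span the symmetric matrices, so [vec] of them has full rank, and their Gram
    matrix has rank [binomial (k+1) 2]; as [vec] is an isometry, that rank also
    forbids smaller factorizations, and the Gram matrix belongs to the set under
    study ([pair_gram_in_psd_mx_set]). These factors have so many zeros that a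
    motion has almost no room ([pair_motion_scalar]): wherever a factor has a
    zero diagonal entry, the motion on one side must be nonnegative and, paired
    with the other side, nonpositive. Minors of order at most two then show that
    every factor is moved proportionally to itself with one common ratio [d].
    Since the factors span, [D = d I].

    In the comments [E_bc] is the matrix unit and [e_b] the unit row vector. *)

(** * Principal minors along a line of matrices *)

Lemma taylor0_id (R : realType) (s : nat) (f : {poly R}) :
  (size f <= s.+1)%N -> taylor0 s f = f.
Proof.
move=> fs; rewrite -[RHS](take_poly_id fs) /take_poly poly_def.
apply: eq_bigr => n _; congr (_ *: _).
rewrite horner_coef0 coef_derivn addn0 ffactnn -[_ *+ _]mulr_natr mulfK //.
by rewrite pnatr_eq0 -lt0n fact_gt0.
Qed.

Lemma size_principal_minor_line (R : realType) (k : nat) (X X' : 'M[R]_k)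
    (I : {set 'I_k}) :
  (size (principal_minor (line_mx X X') I) <= k.+1)%N.
Proof.
apply: (@leq_trans #|I|.+1); last first.
  by rewrite ltnS -[k in leqRHS]card_ord max_card.
apply: (leq_trans (size_sum _ _ _)); apply/bigmax_leqP => s _.
rewrite mulr_sign (fun_if (fun f : {poly R} => size f)) size_polyN if_same.
apply: (leq_trans (size_poly_prod_leq _ _)); rewrite leq_subLR.
rewrite [X in (_ <= X + _)%N](_ : _ = #|I|); last by rewrite -[RHS]card_ord.
rewrite addnS ltnS addnn -muln2 -[X in (_ <= X * 2)%N]card_ord -sum_nat_const.
apply: leq_sum => a _; rewrite !mxE.
apply: (leq_trans (size_polyD _ _)); rewrite geq_max.
rewrite (leq_trans (size_polyC_leq1 _)) // mulrC.
by rewrite (leq_trans (size_polyMleq _ _)) // size_polyX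
  addn2 ltnS size_polyC_leq1.
Qed.

Lemma horner_principal_minor_line (R : realType) (k : nat) (X X' : 'M[R]_k)
    (I : {set 'I_k}) (t : R) :
  (principal_minor (line_mx X X') I).[t] = principal_minor (X + t *: X') I.
Proof.
rewrite -horner_evalE -det_map_mx; congr (\det _); apply/matrixP => a b.
by rewrite !mxE /= /horner_eval !hornerE.
Qed.

(** The minors of the line have degree at most [k] in [t], so truncating them
    at order [k] changes nothing. *)
Lemma horner_taylor0_principal_minor (R : realType) (k : nat)
    (X X' : 'M[R]_k) (I : {set 'I_k}) (t : R) :
  (taylor0 k (principal_minor (line_mx X X') I)).[t] =
  principal_minor (X + t *: X') I.
Proof.
by rewrite taylor0_id ?size_principal_minor_line // horner_principal_minor_line.
Qed.

Lemma principal_minor1 (R : comNzRingType) (k : nat) (X : 'M[R]_k) (a : 'I_k) :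
  principal_minor X [set a]%SET = X a a.
Proof.
rewrite /principal_minor.
move: (@enum_val _ [set a]%SET) (@enum_valP _ [set a]%SET).
rewrite cards1 => f fP; rewrite det_mx11 !mxE.
by move: (fP ord0); rewrite inE => /eqP ->.
Qed.

Lemma principal_minor2 (R : comNzRingType) (k : nat) (X : 'M[R]_k)
    (a b : 'I_k) :
  a != b -> principal_minor X [set a; b]%SET = X a a * X b b - X a b * X b a.
Proof.
move=> ab; rewrite /principal_minor.
move: (@enum_val _ [set a; b]%SET) (@enum_valP _ [set a; b]%SET)
  (@enum_val_inj _ [set a; b]%SET).
rewrite cards2 ab => f fP f_inj.
rewrite (expand_det_row _ ord0) !big_ord_recl big_ord0 /cofactor !det_mx11 !mxE.
have : f ord0 != f (lift ord0 ord0) by apply/eqP => /f_inj.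
have -> : lift (lift ord0 ord0) ord0 = ord0 :> 'I_2 by apply/val_inj.
move: (fP ord0) (fP (lift ord0 ord0)); rewrite !inE.
move=> /orP[] /eqP -> /orP[] /eqP ->; rewrite ?eqxx //= => _; ring.
Qed.

(** * Positive semidefinite matrices *)

Lemma psd_congruence (R : realType) (k m : nat) (X : 'M[R]_k)
    (P : 'M[R]_(m, k)) :
  psd X -> psd (P *m X *m P^T).
Proof.
move=> [sX pX]; split; first by rewrite /symmetric_mx !trmx_mul trmxK sX mulmxA.
by move=> v; have := pX (v *m P); rewrite trmx_mul !mulmxA.
Qed.

Lemma psd_scale (R : realType) (k : nat) (X : 'M[R]_k) (c : R) :
  0 <= c -> psd X -> psd (c *: X).
Proof.
move=> c0 [sX pX]; split; first by rewrite /symmetric_mx linearZ /= sX.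
by move=> v; rewrite -scalemxAr -scalemxAl mxE mulr_ge0.
Qed.

(** If [det X < 0], the monic polynomial [det (x + X)], which is positive for
    large [x], has a root at some [x > 0]; then [-x] is an eigenvalue of [X],
    and an eigenvector for it contradicts semidefiniteness. *)
Lemma psd_det_ge0 (R : realType) (k : nat) (X : 'M[R]_k) :
  psd X -> 0 <= \det X.
Proof.
move=> [_ pX]; pose P := char_poly (- X).
have PE x : P.[x] = \det (x%:M + X).
  rewrite /P /char_poly -horner_evalE -det_map_mx; congr (\det _).
  apply/matrixP => a b; rewrite !mxE /= /horner_eval !hornerE hornerMn hornerX.
  by rewrite opprK.
have [b bP] := monic_Cauchy_bound (char_poly_monic (- X)).
rewrite leNgt; apply/negP => detN.
have P0 : P.[0] < 0 by rewrite PE raddf0 add0r.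
have [||x] := @poly_ivt R P 0 (Num.max b 0).
- by rewrite le_max lexx orbT.
- by rewrite (ltW P0) ltW // bP // le_max lexx.
move=> /andP[x0 _] /rootP Px0.
have {}x0 : 0 < x.
  by rewrite lt_neqAle x0 andbT; apply: contraTneq P0 => e;
    rewrite [in P.[_]]e Px0 ltxx.
move: Px0; rewrite PE => /eqP/det0P[v v0 vX].
have := pX v; have -> : v *m X = - x *: v.
  by apply/eqP; rewrite scaleNr -addr_eq0 addrC -mul_mx_scalar -mulmxDr vX.
rewrite -scalemxAl mxE mulNr oppr_ge0 leNgt pmulr_rgt0 // => /negP[].
rewrite lt_neqAle eq_sym mxE; apply/andP; split; last first.
  by apply: sumr_ge0 => i _; rewrite mxE -expr2 sqr_ge0.
apply: contra_neq v0 => /eqP; rewrite psumr_eq0.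
  move=> /allP v0; apply/rowP => i; apply/eqP; rewrite mxE.
  by have := v0 i; rewrite mem_index_enum mxE mulf_eq0 orbb; apply.
by move=> i _; rewrite mxE -expr2 sqr_ge0.
Qed.

Lemma psd_principal_minor_ge0 (R : realType) (k : nat) (X : 'M[R]_k)
    (I : {set 'I_k}) :
  psd X -> 0 <= principal_minor X I.
Proof.
move=> psdX; apply: psd_det_ge0.
pose P : 'M[R]_(#|I|, k) := rowsub enum_val 1%:M.
suff -> : mxsub enum_val enum_val X = P *m X *m P^T by exact: psd_congruence.
by rewrite trmx_mxsub trmx1 mul_rowsub_mx mul1mx mulmx_colsub mulmx1 -mxsubcr.
Qed.

(** * Coordinates of symmetric matrices *)

Definition vec_positions (k : nat) : seq ('I_k * 'I_k) :=
  [seq (i, i) | i <- enum 'I_k] ++ upper_pairs k.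

Definition vec_weight (R : realType) (k : nat) (P : 'I_k * 'I_k) : R :=
  if P.1 == P.2 then 1 else Num.sqrt 2.

Lemma mem_upper_pairs (k : nat) (P : 'I_k * 'I_k) :
  (P \in upper_pairs k) = (P.1 < P.2)%N.
Proof.
rewrite mem_filter andb_idr // => _; case: P => i j.
by apply/allpairsP; exists (i, j); rewrite !mem_enum.
Qed.

Lemma mem_vec_positions (k : nat) (P : 'I_k * 'I_k) :
  (P \in vec_positions k) = (P.1 <= P.2)%N.
Proof.
rewrite mem_cat mem_upper_pairs [RHS]leq_eqVlt; congr orb.
case: P => i j; apply/mapP/eqP => [[l _ [-> ->]] // | /val_inj /= <-].
by exists i; rewrite ?mem_enum.
Qed.

Lemma uniq_vec_positions (k : nat) : uniq (vec_positions k).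
Proof.
rewrite cat_uniq filter_uniq ?andbT; last first.
  by apply: allpairs_uniq; rewrite ?enum_uniq // => -[? ?] [? ?].
rewrite map_inj_uniq ?enum_uniq => [/= | i j [] //].
apply/hasPn => P; rewrite mem_upper_pairs => ltP; apply/mapP => -[i _ PE].
by rewrite PE ltnn in ltP.
Qed.

Lemma vec_seqE (R : realType) (k : nat) (X : 'M[R]_k) :
  vec_seq X = [seq vec_weight R P * X P.1 P.2 | P <- vec_positions k].
Proof.
rewrite /vec_seq /vec_positions map_cat -[in RHS]map_comp; congr cat.
  by apply: eq_map => i; rewrite /= /vec_weight eqxx mul1r.
apply/eq_in_map => P; rewrite mem_upper_pairs /vec_weight => ltP.
by rewrite ifN // -val_eqE /= ltn_eqF.
Qed.

(** The length is read off [vec_seq] of a matrix, whence the parameter [R]. *)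
Lemma size_vec_positions (R : realType) (k : nat) :
  size (vec_positions k) = 'C(k.+1, 2).
Proof. by rewrite -(size_vec_seq (0 : 'M[R]_k)) vec_seqE size_map. Qed.

Definition vec_position (R : realType) (k : nat) (l : 'I_'C(k.+1, 2)) :
    'I_k * 'I_k :=
  tnth (in_tuple (vec_positions k))
    (cast_ord (esym (size_vec_positions R k)) l).

Lemma vec_position_le (R : realType) (k : nat) (l : 'I_'C(k.+1, 2)) :
  ((vec_position R l).1 <= (vec_position R l).2)%N.
Proof. by rewrite -mem_vec_positions mem_tnth. Qed.

Lemma vec_position_inj (R : realType) (k : nat) :
  injective (@vec_position R k).
Proof.
move=> l m eq_lm; apply: (@cast_ord_inj _ _ (esym (size_vec_positions R k))).
have /tuple_uniqP pos_inj : uniq (in_tuple (vec_positions k)).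
  exact: uniq_vec_positions.
exact: pos_inj.
Qed.

Lemma vec_position_surj (R : realType) (k : nat) (P : 'I_k * 'I_k) :
  (P.1 <= P.2)%N -> exists l, vec_position R l = P.
Proof.
rewrite -mem_vec_positions => P_in.
have /tnthP[m ->] : P \in in_tuple (vec_positions k) by [].
exists (cast_ord (size_vec_positions R k) m).
by rewrite /vec_position cast_ordK.
Qed.

Lemma vecE (R : realType) (k : nat) (X : 'M[R]_k) (l : 'I_'C(k.+1, 2)) :
  vec X 0 l = vec_weight R (vec_position R l) *
    X (vec_position R l).1 (vec_position R l).2.
Proof.
rewrite mxE vec_seqE /vec_position.
rewrite (nth_map (vec_position R l)) ?(size_vec_positions R) //.
by rewrite (tnth_nth (vec_position R l)).
Qed.

Lemma vecB (R : realType) (k : nat) (X Y : 'M[R]_k) :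
  vec (X - Y) = vec X - vec Y.
Proof.
apply/rowP => l; rewrite [RHS]mxE [X in _ = _ + X]mxE !vecE.
by rewrite !mxE mulrBr.
Qed.

Lemma vecZ (R : realType) (k : nat) (c : R) (X : 'M[R]_k) :
  vec (c *: X) = c *: vec X.
Proof. by apply/rowP => l; rewrite [RHS]mxE !vecE mxE mulrCA. Qed.

(** The factor [Num.sqrt 2] of [vec] is what makes it an isometry on
    symmetric matrices: each off-diagonal product occurs twice in the trace. *)
Lemma inner_vec (R : realType) (k : nat) (X Y : 'M[R]_k) :
  symmetric_mx X -> symmetric_mx Y -> inner X Y = (vec X *m (vec Y)^T) 0 0.
Proof.
move=> sX sY; rewrite mxE.
pose F (P : 'I_k * 'I_k) := vec_weight R P ^+ 2 * (X P.1 P.2 * Y P.1 P.2).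
have -> : \sum_j vec X 0 j * (vec Y)^T j 0 = \sum_(P <- vec_positions k) F P.
  rewrite [RHS]big_tnth.
  rewrite [RHS](reindex (cast_ord (esym (size_vec_positions R k)))) /=.
    by apply: eq_bigr => l _; rewrite [X in _ * X]mxE !vecE mulrACA.
  by exists (cast_ord (size_vec_positions R k)) => ? _;
    rewrite ?cast_ordK ?cast_ordKV.
rewrite big_cat big_map big_enum /= big_filter.
rewrite [X in _ + X]big_mkcond /= big_allpairs_dep big_enum /=.
rewrite -big_split /= /inner /mxtrace.
transitivity (\sum_i \sum_j X i j * Y i j).
  apply: eq_bigr => i _; rewrite mxE; apply: eq_bigr => j _.
  by rewrite -[in Y j i]sY mxE.
pose up (i : 'I_k) := \sum_(j < k | (i < j)%N) X i j * Y i j.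
pose dn (i : 'I_k) := \sum_(j < k | (j < i)%N) X i j * Y i j.
transitivity (\sum_i (X i i * Y i i + up i + dn i)).
  apply: eq_bigr => i _; rewrite (bigD1 i) //= -addrA; congr (_ + _).
  rewrite (bigID (fun j : 'I_k => (i < j)%N)) /=; congr (_ + _).
    by apply: eq_bigl => j; rewrite -val_eqE /= eq_sym neq_ltn; case: ltngtP.
  by apply: eq_bigl => j; rewrite -val_eqE /= neq_ltn; case: ltngtP.
rewrite big_split /=.
(* By symmetry the lower triangle contributes as much as the upper one. *)
have -> : \sum_i dn i = \sum_i up i.
  rewrite /dn /up (exchange_big_dep xpredT) //=; apply: eq_bigr => i _.
  by apply: eq_bigr => j _; rewrite -[X in LHS]sX -[Y in LHS]sY !mxE.
rewrite -big_split /=; apply: eq_bigr => i _.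
rewrite -addrA /F /= /vec_weight /= eqxx expr1n mul1r; congr (_ + _).
rewrite -mulr2n big_enum -big_mkcond /= /up -sumrMnl; apply: eq_bigr => j ij.
rewrite ifN; last by rewrite -val_eqE /= ltn_eqF.
by rewrite sqr_sqrtr ?ler0n // mulr_natl.
Qed.

(** * The standard factorization *)

Definition pair_vec (R : realType) (k : nat) (P : 'I_k * 'I_k) : 'rV[R]_k :=
  \row_x ((x == P.1) || (x == P.2))%:R.

(** These rank one matrices are [E_bb] for [P = (b, b)], and otherwise the
    square of [e_b + e_c]; their span is the space of symmetric matrices. *)
Definition pair_mx (R : realType) (k : nat) (P : 'I_k * 'I_k) : 'M[R]_k :=
  (pair_vec R P)^T *m pair_vec R P.

Lemma pair_mxE (R : realType) (k : nat) (P : 'I_k * 'I_k) (x y : 'I_k) :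
  pair_mx R P x y =
    ((x == P.1) || (x == P.2))%:R * ((y == P.1) || (y == P.2))%:R.
Proof. by rewrite mxE big_ord1 !mxE. Qed.

Lemma pair_mx_psd (R : realType) (k : nat) (P : 'I_k * 'I_k) :
  psd (pair_mx R P).
Proof.
split; first by rewrite /symmetric_mx trmx_mul trmxK.
move=> v; rewrite !mulmxA -mulmxA -[v *m _]trmxK trmx_mul trmxK.
by rewrite mxE big_ord1 mxE -expr2 sqr_ge0.
Qed.

Lemma inner_sym (R : realType) (k : nat) (X Y : 'M[R]_k) :
  inner X Y = inner Y X.
Proof. exact: mxtrace_mulC. Qed.

Lemma inner_pair (R : realType) (k : nat) (Z : 'M[R]_k) (P : 'I_k * 'I_k) :
  inner Z (pair_mx R P) = (pair_vec R P *m Z *m (pair_vec R P)^T) 0 0.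
Proof. by rewrite /inner mulmxA mxtrace_mulC mulmxA trace_mx11. Qed.

Lemma delta_form (R : realType) (k : nat) (Z : 'M[R]_k) (b c : 'I_k) :
  ((delta_mx 0 b : 'rV_k) *m Z *m (delta_mx 0 c : 'rV_k)^T) 0 0 = Z b c.
Proof. by rewrite -rowE trmx_delta -colE !mxE. Qed.

Lemma inner_pair_diag (R : realType) (k : nat) (Z : 'M[R]_k) (b : 'I_k) :
  inner Z (pair_mx R (b, b)) = Z b b.
Proof.
rewrite inner_pair (_ : pair_vec R (b, b) = delta_mx 0 b) ?delta_form //.
by apply/rowP => x; rewrite !mxE eqxx orbb.
Qed.

Lemma inner_pair_off (R : realType) (k : nat) (Z : 'M[R]_k) (b c : 'I_k) :
  b != c -> inner Z (pair_mx R (b, c)) = Z b b + Z b c + Z c b + Z c c.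
Proof.
move=> bc; rewrite inner_pair.
have -> : pair_vec R (b, c) = delta_mx 0 b + delta_mx 0 c.
  apply/rowP => x; rewrite !mxE eqxx /=.
  by case: eqVneq => [->|_] /=; rewrite ?(negPf bc) ?addr0 ?add0r.
rewrite linearD /= !mulmxDl !mulmxDr.
rewrite [LHS]mxE [X in X + _]mxE [X in _ + X]mxE.
by rewrite !delta_form !addrA.
Qed.

Lemma vec_pair_diag (R : realType) (k : nat) (l : 'I_'C(k.+1, 2)) :
  (vec_position R l).1 = (vec_position R l).2 ->
  vec (pair_mx R (vec_position R l)) = delta_mx 0 l.
Proof.
case Pl: (vec_position R l) => [b c] /= eq_bc; rewrite -{c}eq_bc in Pl *.
apply/rowP => m; rewrite vecE pair_mxE [RHS]mxE eqxx /=.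
rewrite -(inj_eq (@vec_position_inj R k)) Pl /vec_weight.
case: (vec_position R m) => [x y] /=; rewrite xpair_eqE !orbb -mulnb natrM.
case: (eqVneq x b) => [->|_]; rewrite ?mul0r ?mulr0 // mul1r eq_sym.
by case: eqVneq => _; rewrite ?mul1r ?mulr1 ?mulr0.
Qed.

(** The square of [e_b + e_c], minus [E_bb] and [E_cc], is [E_bc + E_cb], so
    each off-diagonal coordinate vector is a combination of three of the
    [vec (pair_mx R P)]. *)
Lemma vec_pair_off (R : realType) (k : nat) (l : 'I_'C(k.+1, 2)) :
  let P := vec_position R l in P.1 != P.2 ->
  vec (pair_mx R P - pair_mx R (P.1, P.1) - pair_mx R (P.2, P.2)) =
  Num.sqrt 2 *: delta_mx 0 l.
Proof.
have := vec_position_le R l; case Pl: (vec_position R l) => [b c] /= bc neq_bc.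
apply/rowP => m; rewrite vecE [RHS]mxE [X in _ = _ * X]mxE eqxx /=.
rewrite -(inj_eq (@vec_position_inj R k)) Pl; have := vec_position_le R m.
case: (vec_position R m) => [x y] /= xy; rewrite xpair_eqE /vec_weight /=.
have entry (Z1 Z2 Z3 : 'M[R]_k) : (Z1 - Z2 - Z3) x y = Z1 x y - Z2 x y - Z3 x y.
  by rewrite !mxE.
rewrite entry !pair_mxE /= !orbb.
case: (eqVneq x b) => [xb|_]; case: (eqVneq x c) => [xc|_];
  case: (eqVneq y b) => [yb|_]; case: (eqVneq y c) => [yc|_]; subst; 
  rewrite ?eqxx ?(negPf neq_bc) //=; try ring; try by case/eqP: neq_bc.
(* (x, y) = (c, b) is below the diagonal *)
by case/eqP: neq_bc; apply/val_inj/anti_leq; rewrite bc.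
Qed.

Definition vec_rows (R : realType) (k n : nat) (A : 'I_n -> 'M[R]_k) :
    'M[R]_(n, 'C(k.+1, 2)) :=
  \matrix_i vec (A i).

Lemma factorization_vec_rows (R : realType) (p q k : nat) (M : 'M[R]_(p, q))
    (A : 'I_p -> 'M[R]_k) (B : 'I_q -> 'M[R]_k) :
  psd_factorization M A B -> M = vec_rows A *m (vec_rows B)^T.
Proof.
move=> [pA pB MAB]; apply/matrixP => i j; rewrite MAB.
rewrite (inner_vec (proj1 (pA i)) (proj1 (pB j))) [LHS]mxE [RHS]mxE.
by apply: eq_bigr => l _; rewrite !mxE.
Qed.

(** Zero factors pad the list to length [n]; they change neither the span nor
    the constraints on the motion of the other factors. *)
Definition pair_family (R : realType) (k n : nat) (i : 'I_n) : 'M[R]_k :=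
  if insub (i : nat) is Some l then pair_mx R (vec_position R l) else 0.

Lemma pair_family_widen (R : realType) (k n : nat)
    (hn : ('C(k.+1, 2) <= n)%N) l :
  pair_family R k (widen_ord hn l) = pair_mx R (vec_position R l).
Proof. by rewrite /pair_family valK. Qed.

Lemma pair_family_psd (R : realType) (k n : nat) (i : 'I_n) :
  psd (pair_family R k i).
Proof.
rewrite /pair_family; case: insubP => [l _ _|_]; first exact: pair_mx_psd.
split; first by rewrite /symmetric_mx trmx0.
by move=> v; rewrite mulmx0 mul0mx mxE.
Qed.

Lemma pair_family_ge0 (R : realType) (k n : nat) (i : 'I_n) (x y : 'I_k) :
  0 <= pair_family R k i x y.
Proof.
rewrite /pair_family; case: insubP => [l _ _|_]; last by rewrite mxE.
by rewrite pair_mxE mulr_ge0.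
Qed.

Lemma row_full_pair_family (R : realType) (k n : nat) :
  ('C(k.+1, 2) <= n)%N -> row_full (vec_rows (@pair_family R k n)).
Proof.
move=> hn; rewrite -sub1mx; apply/row_subP => l; rewrite row1.
have vec_sub (b c : 'I_k) : (b <= c)%N ->
    (vec (pair_mx R (b, c)) <= vec_rows (@pair_family R k n))%MS.
  move=> bc; have [m Pm] := @vec_position_surj R k (b, c) bc.
  by rewrite -Pm -(pair_family_widen R hn); apply: eq_row_sub (rowK _ _).
have := vec_position_le R l; case P: (vec_position R l) => [b c] bc.
have [eq_bc|neq_bc] := eqVneq b c.
  by rewrite -(@vec_pair_diag R k l) P //= vec_sub.
have r2 : Num.sqrt 2 != 0 :> R by rewrite sqrtr_eq0 -ltNge ltr0n.
have := @vec_pair_off R k l; rewrite P => /(_ neq_bc) E.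
rewrite -[delta_mx 0 l](scalerK r2) -E !vecB.
by rewrite scalemx_sub // !addmx_sub ?eqmx_opp ?vec_sub.
Qed.

(** Through [vec], a size [m] factorization writes [M] as a product with inner
    dimension [binomial (m+1) 2], which bounds its rank. *)
Lemma factorization_size_ge (R : realType) (p q k m : nat) (M : 'M[R]_(p, q))
    (A : 'I_p -> 'M[R]_m) (B : 'I_q -> 'M[R]_m) :
  \rank M = 'C(k.+1, 2) -> psd_factorization M A B -> (k <= m)%N.
Proof.
move=> rM /factorization_vec_rows ME; rewrite leqNgt; apply/negP => mk.
have : (\rank M <= 'C(m.+1, 2))%N.
  by rewrite ME (leq_trans (mxrankM_maxl _ _)) // rank_leq_col.
apply/negP; rewrite -ltnNge rM [in ltnRHS]binS bin1.
by rewrite -[ltnLHS]addn0 -addnS leq_add ?leq_bin2l // (leq_ltn_trans _ mk).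
Qed.

Definition pair_gram (R : realType) (k p q : nat) : 'M[R]_(p, q) :=
  \matrix_(i, j) inner (pair_family R k i) (pair_family R k j).

Lemma pair_gram_factorization (R : realType) (k p q : nat) :
  psd_factorization (pair_gram R k p q) (@pair_family R k p)
    (@pair_family R k q).
Proof. by split=> *; rewrite ?mxE //; exact: pair_family_psd. Qed.

Lemma pair_gram_in_psd_mx_set (R : realType) (k p q : nat) :
  ('C(k.+1, 2) <= p)%N -> ('C(k.+1, 2) <= q)%N ->
  psd_mx_set R p q k (pair_gram R k p q).
Proof.
move=> hp hq; have fact := pair_gram_factorization R k p q.
have rM : \rank (pair_gram R k p q) = 'C(k.+1, 2).
  rewrite (factorization_vec_rows fact) mxrankMfree.
    exact/eqP/row_full_pair_family.
  by rewrite /row_free mxrank_tr; exact: row_full_pair_family.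
split=> //.
  move=> i j; rewrite mxE; apply: sumr_ge0 => x _; rewrite mxE.
  by apply: sumr_ge0 => y _; rewrite mulr_ge0 ?pair_family_ge0.
split; first by exists (@pair_family R k p), (@pair_family R k q).
by move=> m A B; exact: factorization_size_ge.
Qed.

(** * Rigidity of the standard factorization *)

(** Minors of order one and two already carry all of the rigidity of the
    standard factorization. *)
Definition line_minors2_ge0 (R : realType) (k : nat) (eps : R)
    (A A' : 'M[R]_k) : Prop :=
  forall t, 0 <= t < eps ->
    (forall a, 0 <= (A + t *: A') a a) /\
    (forall a b, a != b ->
      0 <= (A + t *: A') a a * (A + t *: A') b b
           - (A + t *: A') a b * (A + t *: A') b a).

Lemma line_diag_ge0 (R : realType) (k : nat) (eps : R) (A A' : 'M[R]_k)
    (a : 'I_k) :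
  0 < eps -> line_minors2_ge0 eps A A' -> A a a = 0 -> 0 <= A' a a.
Proof.
move=> e0 /(_ (eps / 2)) []; first by rewrite divr_ge0 ?ltW //=; lra.
move=> /(_ a) + _ Aa; rewrite !mxE Aa add0r pmulr_rge0 // divr_gt0 //.
Qed.

Lemma line_offdiag_eq0 (R : realType) (k : nat) (eps : R) (A A' : 'M[R]_k)
    (a b : 'I_k) :
  0 < eps -> line_minors2_ge0 eps A A' -> symmetric_mx A' ->
  A a a = 0 -> A' a a = 0 -> A a b = 0 -> A b a = 0 -> a != b -> A' a b = 0.
Proof.
move=> e0 /(_ (eps / 2)) []; first by rewrite divr_ge0 ?ltW //=; lra.
move=> _ minor sA' Aa A'a Aab Aba /minor; rewrite !mxE Aa A'a Aab Aba.
have -> : A' b a = A' a b by rewrite -[in LHS]sA' mxE.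
rewrite mulr0 !add0r mul0r sub0r oppr_ge0 -expr2 => h.
have := sqr_ge0 (eps / 2 * A' a b) => h'.
have /eqP : (eps / 2 * A' a b) ^+ 2 = 0 by apply/eqP; rewrite eq_le h h'.
by rewrite sqrf_eq0 !mulf_eq0 invr_eq0 pnatr_eq0 /= orbF (gt_eqF e0) => /eqP.
Qed.

(** Expanding at [t = 0], the terms of order one are opposite in the two
    inequalities, so [2 m = l1 + l2]; the terms of order two then give
    [l1 * l2 >= m ^ 2], hence [l1 = l2] by the inequality of arithmetic and
    geometric means. *)
Lemma opposite_minors_eq (R : realType) (eps l1 l2 m : R) :
  0 < eps ->
  (forall t, 0 <= t < eps ->
    0 <= (1 + t * l1) * (1 + t * l2) - (1 + t * m) ^+ 2) ->
  (forall t, 0 <= t < eps ->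
    0 <= (1 - t * l1) * (1 - t * l2) - (1 - t * m) ^+ 2) ->
  l1 = l2 /\ m = l1.
Proof.
move=> e0 h1 h2; pose s := l1 + l2 - 2 * m; pose d := l1 * l2 - m ^+ 2.
(* Both inequalities, divided by [t]. *)
have bound t : 0 < t < eps -> `|s| <= t * d.
  move=> /andP[t0 te]; have te' : 0 <= t < eps by rewrite ltW.
  have {}h1 := h1 t te'; have {}h2 := h2 t te'.
  rewrite ler_norml; apply/andP; split; rewrite -(ler_pM2l t0) /s /d; lra.
have d0 : 0 <= d.
  have e2 : 0 < eps / 2 by rewrite divr_gt0.
  rewrite -(pmulr_rge0 _ e2); apply: le_trans (bound _ _) => //.
  by rewrite e2 /=; lra.
have s0 : s = 0.
  apply/eqP; rewrite -normr_le0 leNgt; apply/negP => s0.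
  (* This [t] is small enough that [t * d] stays below [`|s|]. *)
  pose t := Num.min (eps / 2) (`|s| / (2 * (d + 1))).
  have t0 : 0 < t by rewrite lt_min !divr_gt0 // mulr_gt0 // ltr_wpDl.
  have te : t < eps by rewrite gt_min; apply/orP; left; lra.
  have := bound t; rewrite t0 te => /(_ isT); apply/negP; rewrite -ltNge.
  have : t * (2 * (d + 1)) <= `|s|.
    by rewrite -ler_pdivlMr ?mulr_gt0 ?ltr_wpDl // ge_min lexx orbT.
  nra.
have /eqP : (l1 - l2) ^+ 2 = 0.
  by apply/eqP; rewrite eq_le sqr_ge0 andbT; move: s0 d0; rewrite /s /d; nra.
rewrite sqrf_eq0 subr_eq0 => /eqP l12; split=> //.
by move: s0; rewrite /s l12; lra.
Qed.

Lemma symmetric_row0_pair (R : realType) (k : nat) (Z : 'M[R]_k) (b : 'I_k) :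
  symmetric_mx Z -> (forall x y, x != b -> Z x y = 0) ->
  Z = Z b b *: pair_mx R (b, b).
Proof.
move=> sZ Z0; apply/matrixP => x y; rewrite mxE pair_mxE /= !orbb.
have [->|xb] := eqVneq x b; last by rewrite Z0 // mul0r mulr0.
have [->|yb] := eqVneq y b; first by rewrite !mulr1.
by rewrite -sZ mxE Z0 // !mulr0.
Qed.

(** The diagonal of [X P] is its inner product with the factors [E_aa].
    For [b != a] the numbers [X (b, b) a a] and [Y (a, a) b b] are nonnegative,
    since [E_bb] and [E_aa] are zero at these diagonal places, and they are
    opposite because inner products are preserved to first order: both vanish.
    A vanishing diagonal entry kills its row, so [X (b, b) = l b *: E_bb] and
    [Y (b, b) = - l b *: E_bb]. This gives the diagonal of every other [X P],
    and the minors at [{b, c}] on both sides force [l b = l c]. *)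
Lemma pair_motion_scalar (R : realType) (k : nat) (eps : R)
    (X Y : 'I_k * 'I_k -> 'M[R]_k) :
  (0 < k)%N -> 0 < eps ->
  (forall P : 'I_k * 'I_k, (P.1 <= P.2)%N ->
    [/\ symmetric_mx (X P), symmetric_mx (Y P),
        line_minors2_ge0 eps (pair_mx R P) (X P)
      & line_minors2_ge0 eps (pair_mx R P) (Y P)]) ->
  (forall P Q : 'I_k * 'I_k, (P.1 <= P.2)%N -> (Q.1 <= Q.2)%N ->
    inner (X P) (pair_mx R Q) + inner (pair_mx R P) (Y Q) = 0) ->
  exists d, forall P : 'I_k * 'I_k, (P.1 <= P.2)%N -> X P = d *: pair_mx R P.
Proof.
move=> k0 e0 XY inner0; pose l b := X (b, b) b b.
have inner0' (P : 'I_k * 'I_k) b : (P.1 <= P.2)%N ->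
    X P b b + inner (pair_mx R P) (Y (b, b)) = 0.
  by move=> hP; rewrite -inner_pair_diag inner0 /=.
have inner0'' (Q : 'I_k * 'I_k) b : (Q.1 <= Q.2)%N ->
    inner (pair_mx R Q) (X (b, b)) + Y Q b b = 0.
  by move=> hQ; rewrite -[Y Q b b]inner_pair_diag inner_sym
    [X in _ + X]inner_sym inner0 /=.
have Xdiag0 a b : a != b -> X (b, b) a a = 0 /\ Y (a, a) b b = 0.
  move=> ab; have [_ _ mX _] := XY (b, b) (leqnn b).
  have [_ _ _ mY] := XY (a, a) (leqnn a).
  have X0 : 0 <= X (b, b) a a.
    by apply: line_diag_ge0 mX _ => //; rewrite pair_mxE /= (negPf ab) mul0r.
  have Y0 : 0 <= Y (a, a) b b.
    by apply: line_diag_ge0 mY _ => //;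
      rewrite pair_mxE /= eq_sym (negPf ab) mul0r.
  have := inner0' (b, b) a (leqnn b); rewrite inner_sym inner_pair_diag.
  by move=> /eqP; rewrite paddr_eq0 // => /andP[/eqP -> /eqP ->].
have Ydiag b : Y (b, b) b b = - l b.
  apply/eqP; rewrite -addr_eq0 addrC; apply/eqP.
  by have := inner0' (b, b) b (leqnn b); rewrite inner_sym inner_pair_diag.
(* In a rank one factor a zero diagonal entry makes the whole row zero, so a
   motion with zero velocity at that entry has zero velocity on
   the row, by the minors of order two. *)
have off0 (P : 'I_k * 'I_k) x y :
    (P.1 <= P.2)%N -> pair_mx R P x x = 0 -> x != y ->
    (X P x x = 0 -> X P x y = 0) /\ (Y P x x = 0 -> Y P x y = 0).
  move=> hP Pxx xy; have [sX sY mX mY] := XY P hP.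
  have Px : ((x == P.1) || (x == P.2))%:R = 0 :> R.
    by move/eqP: Pxx; rewrite pair_mxE mulf_eq0 orbb => /eqP.
  by split=> Z0; [apply: line_offdiag_eq0 mX _ _ _ _ _ _ |
    apply: line_offdiag_eq0 mY _ _ _ _ _ _];
    rewrite // pair_mxE Px ?mul0r ?mulr0.
have XYdiag b : X (b, b) = l b *: pair_mx R (b, b) /\
    Y (b, b) = - l b *: pair_mx R (b, b).
  have [sX sY _ _] := XY (b, b) (leqnn b).
  have row0 x y : x != b -> X (b, b) x y = 0 /\ Y (b, b) x y = 0.
    move=> xb; have [X0 _] := Xdiag0 _ _ xb.
    have [_ Y0] : X (x, x) b b = 0 /\ Y (b, b) x x = 0.
      by apply: Xdiag0; rewrite eq_sym.
    have [<- //|xy] := eqVneq x y.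
    have [|offX offY] := off0 (b, b) x y (leqnn b) _ xy.
      by rewrite pair_mxE /= (negPf xb) mul0r.
    by rewrite offX ?offY.
  have [rowX0 rowY0] := (fun x y xb => proj1 (row0 x y xb),
    fun x y xb => proj2 (row0 x y xb)).
  split; first exact: symmetric_row0_pair sX rowX0.
  by rewrite -Ydiag; exact: symmetric_row0_pair sY rowY0.
have diag (P : 'I_k * 'I_k) b : (P.1 <= P.2)%N ->
    X P b b = l b * pair_mx R P b b /\
    Y P b b = - l b * pair_mx R P b b.
  move=> hP; have [Xb Yb] := XYdiag b; split.
    apply/eqP; rewrite -subr_eq0 -(inner0' _ b hP) Yb inner_sym.
    by rewrite /inner -scalemxAl mxtraceZ -/(inner _ _) inner_sym
      inner_pair_diag mulNr.
  apply/eqP; rewrite -subr_eq0 -(inner0'' _ b hP) Xb inner_sym addrC.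
  by rewrite /inner -scalemxAl mxtraceZ -/(inner _ _) inner_sym
      inner_pair_diag mulNr opprK.
have off (b c : 'I_k) : (b < c)%N -> l b = l c /\ X (b, c) b c = l b.
  move=> bc; have hP : ((b, c).1 <= (b, c).2)%N by exact: ltnW.
  have neq_bc : b != c by rewrite -val_eqE /= ltn_eqF.
  have [sX sY mX mY] := XY _ hP.
  have Gentry x y : x \in [:: b; c] -> y \in [:: b; c] ->
      pair_mx R (b, c) x y = 1.
    by rewrite !inE pair_mxE /= => -> ->; rewrite mulr1.
  have [inb inc] : b \in [:: b; c] /\ c \in [:: b; c].
    by rewrite !inE !eqxx orbT.
  have [[Xbb Ybb] [Xcc Ycc]] := (diag _ b hP, diag _ c hP).
  rewrite !Gentry // !mulr1 in Xbb Ybb Xcc Ycc.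
  have Xcb : X (b, c) c b = X (b, c) b c by rewrite -[in LHS]sX mxE.
  have Ycb : Y (b, c) c b = Y (b, c) b c by rewrite -[in LHS]sY mxE.
  have Ybc : Y (b, c) b c = - X (b, c) b c.
    have := inner0 _ _ hP hP; rewrite [X in _ + X]inner_sym !inner_pair_off //.
    by rewrite Xbb Ybb Xcc Ycc Xcb Ycb; lra.
  have entry (A Z : 'M[R]_k) t x y : (A + t *: Z) x y = A x y + t * Z x y.
    by rewrite !mxE.
  have [t /mX[_ /(_ b c neq_bc)]|t /mY[_ /(_ b c neq_bc)]|-> ->] :=
      @opposite_minors_eq _ eps (l b) (l c) (X (b, c) b c) e0; last by [].
    by rewrite !entry !Gentry // Xbb Xcc Xcb expr2.
  by rewrite !entry !Gentry // Ybb Ycc Ycb Ybc !mulrN expr2.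
exists (l (Ordinal k0)) => P hP.
have lE b : l b = l (Ordinal k0).
  have [->//|b0] := eqVneq b (Ordinal k0).
  have b_gt0 : (Ordinal k0 < b)%N by rewrite lt0n.
  by have [-> _] := off _ _ b_gt0.
have [sX _ _ _] := XY P hP.
apply/matrixP => x y; rewrite [RHS]mxE -(lE x).
have [<-|xy] := eqVneq x y; first by have [] := diag P x hP.
have diag0 z : (z == P.1) || (z == P.2) = false ->
    pair_mx R P z z = 0 /\ X P z z = 0.
  by move=> Pz; have [-> _] := diag P z hP; rewrite pair_mxE Pz !mulr0.
rewrite pair_mxE.
case Px: ((x == P.1) || _); last first.
  rewrite mul0r mulr0; have [Gxx Xxx] := diag0 x Px.
  by have [-> ] := off0 P x y hP Gxx xy.
case Py: ((y == P.1) || _); last first.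
  rewrite mulr0 mulr0 -sX mxE; have [Gyy Xyy] := diag0 y Py.
  have yx : y != x by rewrite eq_sym.
  by have [-> ] := off0 P y x hP Gyy yx.
have P12 : (P.1 < P.2)%N.
  rewrite ltn_neqAle hP andbT; apply: contra xy => /eqP/val_inj eP.
  by move: Px Py; rewrite eP !orbb => /eqP -> /eqP ->.
rewrite !mulr1; case: P P12 sX Px Py {hP diag0} => b c /= bc sX.
have [_ Xbc] := off b c bc; rewrite lE -(lE b).
case/orP=> /eqP ex /orP[] /eqP ey; subst; rewrite ?eqxx // in xy *.
by rewrite -sX mxE Xbc.
Qed.

(** * Scalar motions *)

(** With [t * `|d| <= 1] the matrices [(1 + t * d) *: A] and
    [(1 - t * d) *: B] stay psd; the two first order changes of
    [inner (A i) (B j)] cancel. *)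
Lemma scalar_infinitesimal_motion (R : realType) (p q k : nat) (d : R)
    (A : 'I_p -> 'M[R]_k) (B : 'I_q -> 'M[R]_k) :
  (forall i, psd (A i)) -> (forall j, psd (B j)) ->
  infinitesimal_motion k A B (fun i => d *: A i) (fun j => - d *: B j).
Proof.
move=> psdA psdB; have minor_ge0 (c t : R) (X : 'M[R]_k) I :
    0 <= t < (1 + `|d|)^-1 ->
    `|c| = `|d| -> psd X ->
    0 <= (taylor0 k (principal_minor (line_mx X (c *: X)) I)).[t].
  move=> /andP[t0 te] cd psdX; rewrite horner_taylor0_principal_minor.
  apply: psd_principal_minor_ge0.
  rewrite scalerA -[X in X + _]scale1r -scalerDl.
  apply: psd_scale psdX.
  have td : t * (1 + `|d|) <= 1.
    by rewrite -ler_pdivlMr ?div1r ?ltW // ltr_wpDr.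
  have := ler_norm (- (t * c)); rewrite normrN normrM cd (ger0_norm t0).
  by lra.
split.
- by move=> i; rewrite /symmetric_mx linearZ /= (proj1 (psdA i)).
- by move=> j; rewrite /symmetric_mx linearZ /= (proj1 (psdB j)).
- move=> i j; rewrite /inner -scalemxAl -scalemxAr !mxtraceZ -mulrDl subrr.
  by rewrite mul0r.
- exists (1 + `|d|)^-1; first by rewrite invr_gt0 ltr_wpDr.
  by move=> t I ht _; split=> [i|j]; apply: minor_ge0; rewrite ?normrN.
Qed.

Lemma scalar_motion_given_by (R : realType) (p q k : nat) (d : R)
    (A : 'I_p -> 'M[R]_k) (B : 'I_q -> 'M[R]_k) :
  motion_given_by (d *: 1%:M) A B (fun i => d *: A i) (fun j => - d *: B j).
Proof.
split=> [i|j]; rewrite vecZ; first by rewrite -scalemxAr mulmx1.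
by rewrite linearZ /= -scalemxAl mul1mx scaleNr.
Qed.

(** [pair_motion_scalar] gives one ratio [d] for all factors; the rows
    [vec (A i)] have a left inverse, so [vec (A i) *m D = d *: vec (A i)] for
    all [i] determines [D]. *)
Lemma pair_family_motion_scalar (R : realType) (p q k : nat)
    (D : 'M[R]_'C(k.+1, 2)) A' B' :
  (0 < k)%N -> ('C(k.+1, 2) <= p)%N -> ('C(k.+1, 2) <= q)%N ->
  motion_given_by D (@pair_family R k p) (@pair_family R k q) A' B' ->
  infinitesimal_motion k (@pair_family R k p) (@pair_family R k q) A' B' ->
  exists d, D = d *: 1%:M.
Proof.
move=> k0 hp hq [DA _] [sA sB innerAB [eps e0 minorAB]].
have minors n (hn : ('C(k.+1, 2) <= n)%N) (F' : 'I_n -> 'M[R]_k) :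
    (forall t (I : {set 'I_k}) i, 0 <= t < eps -> (0 < #|I|)%N ->
      0 <= principal_minor (pair_family R k i + t *: F' i) I) ->
    forall l, line_minors2_ge0 eps (pair_mx R (vec_position R l))
      (F' (widen_ord hn l)).
  move=> minor_ge0 l t ht; rewrite -(pair_family_widen R hn).
  split=> [a|a b ab].
    by rewrite -principal_minor1 minor_ge0 // cards1.
  by rewrite -principal_minor2 // minor_ge0 // cards2.
have minorA : forall l, line_minors2_ge0 eps (pair_mx R (vec_position R l))
    (A' (widen_ord hp l)).
  apply: minors => t I i ht I0; rewrite -horner_taylor0_principal_minor.
  by have [] := minorAB t I ht I0.
have minorB : forall l, line_minors2_ge0 eps (pair_mx R (vec_position R l))
    (B' (widen_ord hq l)).
  apply: minors => t I i ht I0; rewrite -horner_taylor0_principal_minor.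
  by have [] := minorAB t I ht I0.
pose at_pair n (hn : ('C(k.+1, 2) <= n)%N) (F' : 'I_n -> 'M[R]_k) P :=
  oapp (fun l => F' (widen_ord hn l)) 0 [pick l | vec_position R l == P].
have at_pairE n hn F' l :
    at_pair n hn F' (vec_position R l) = F' (widen_ord hn l).
  rewrite /at_pair; case: pickP => [m /eqP/vec_position_inj -> //|].
  by move=> /(_ l); rewrite eqxx.
have [||d A'E] := @pair_motion_scalar R k eps
  (at_pair p hp A') (at_pair q hq B') k0 e0.
- by move=> P /(@vec_position_surj R)[l <-]; rewrite !at_pairE.
- move=> P Q /(@vec_position_surj R)[l <-] /(@vec_position_surj R)[m <-].
  have := innerAB (widen_ord hp l) (widen_ord hq m).
  by rewrite !at_pairE !pair_family_widen.
exists d; have /row_fullP[V VK] := row_full_pair_family R hp.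
suff VD : vec_rows (@pair_family R k p) *m D =
    d *: vec_rows (@pair_family R k p).
  by rewrite -[D]mul1mx -VK -mulmxA VD scalemxAr.
apply/row_matrixP => i; rewrite row_mul linearZ /= rowK.
have [ltiN|geNi] := ltnP i 'C(k.+1, 2); last first.
  have -> : pair_family R k i = 0 by rewrite /pair_family insubN // -leqNgt.
  by rewrite -(scale0r (0 : 'M_k)) vecZ scale0r mul0mx scaler0.
have -> : i = widen_ord hp (Ordinal ltiN) by exact/val_inj.
by rewrite -DA pair_family_widen -vecZ -A'E ?at_pairE ?vec_position_le.
Qed.

Theorem theorem3 (R : realType) (k p q : nat) (hk : (0 < k)%N)
    (hp : ('C(k.+1, 2) <= p)%N) (hq : ('C(k.+1, 2) <= q)%N) :
  trivial_motions R p q k k =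
  [set D : 'M[R]_'C(k.+1, 2) | exists d : R, D = d *: 1%:M].
Proof.
have fact := pair_gram_factorization R k p q.
have in_set := pair_gram_in_psd_mx_set R hp hq.
apply/seteqP; split=> [D [M [A [B [A' [B' [_ _ _ _ all_motion]]]]]]|D [d ->]].
  have [A'' [B'' [given motion]]] := all_motion _ _ _ in_set fact.
  exact: pair_family_motion_scalar hk hp hq given motion.
have [psdA psdB _] := fact.
exists (pair_gram R k p q), (@pair_family R k p), (@pair_family R k q).
exists (fun i => d *: pair_family R k i), (fun j => - d *: pair_family R k j).
split=> //; first exact: scalar_infinitesimal_motion.
  exact: scalar_motion_given_by.
move=> M A B _ [pA pB _].
exists (fun i => d *: A i), (fun j => - d *: B j).
by split; [exact: scalar_motion_given_by | exact: scalar_infinitesimal_motion].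
Qed.
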